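(* Let $\kappa$ be a regular uncountable cardinal, $\mathbf k$ an exponential field, and assume that $\mathbb K=\mathbf k((G))_\kappa$ has an analytic logarithm $\log$. Then: (1) $\mathbb K$ has an omega-map $\omega:\mathbb K\cong G$ if and only if $G$ is isomorphic to $G^{>1}$ as a chain; (2) moreover, if $G\cong G^{>1}$ as chains, there is an omega-map $\omega$ and a chain isomorphism $h:\mathbb K\cong\mathbb K^{>0}$ such that the logarithm $\log_{\omega,h}$ induced by $\omega$ and $h$ coincides with $\log$.
   Context: An exponential field is a real closed field $\mathbf k$ with an ordered group isomorphism $(\mathbf k,+,0,<)\cong(\mathbf k^{>0},\cdot,1,<)$ (its inverse is the logarithm of $\mathbf k$). $\mathbf k((G))$ is the Hahn field of formal series $\sum_{g\in G}g\,r_g$ ($G$ a multiplicative ordered abelian group) with reverse well-ordered support, Cauchy product, ordered by the sign of the leading coefficient; $\mathbf k((G))_\kappa$ is the subfield of series with support of reverse order type $<\kappa$. $x\prec y$ means $c|x|<|y|$ for all $c\in\mathbf k^{>0}$, $o(1)=\{x:x\prec1\}$. As a chain, $G$ is its underlying linear order. An omega-map is an ordered group isomorphism $\omega:(\mathbb K,+,0,<)\cong(G,\cdot,1,<)$, written $x\mapsto\omega^x$. An analytic logarithm on $\mathbb K$ is a surjective order-preserving homomorphism $\log:(\mathbb K^{>0},\cdot)\to(\mathbb K,+)$ extending the logarithm of $\mathbf k$, with $\log(1+\varepsilon)=\sum_{n\ge1}(-1)^{n+1}\varepsilon^n/n$ for $\varepsilon\prec1$, and $\log(G)=\mathbf k((G^{>1}))\cap\mathbb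 K$. Given an omega-map $\omega$ and a chain isomorphism (order-preserving bijection) $h:\mathbb K\to\mathbb K^{>0}$, $\log_{\omega,h}$ is defined by: for $x=\sum_{i<\alpha}\omega^{x_i}r_i$ (decreasing enumeration of the support, $r_i\in\mathbf k^\times$), $\log_{\omega,h}(\omega^x)=\sum_{i<\alpha}\omega^{h(x_i)}r_i$; and for $y=g\,r(1+\varepsilon)$ with $g\in G$, $r\in\mathbf k^{>0}$, $\varepsilon\in o(1)$, $\log_{\omega,h}(y)=\log_{\omega,h}(g)+\log r+\sum_{n\ge1}(-1)^{n+1}\varepsilon^n/n$. *)

(* Defs.v *)
From HB Require Import structures.
From mathcomp Require Import all_boot all_order all_algebra.
From mathcomp Require Import boolp classical_sets functions cardinality fsbigop.

Set Implicit Arguments.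
Unset Strict Implicit.
Unset Printing Implicit Defensive.

Import Order.TTheory GRing.Theory Num.Theory.

Local Open Scope classical_set_scope.
Local Open Scope ring_scope.

HB.mixin Record Group_isOrderedAbelian (d : Order.disp_t) G
    of Group G & Order.Total d G := {
  oabg_mulC : forall x y : G, (x * y = y * x)%g;
  oabg_lt_mul2l : forall x y z : G, (x < y)%O -> ((z * x)%g < (z * y)%g)%O
}.

#[short(type="oAbGroupType")]
HB.structure Definition OAbGroup (d : Order.disp_t) :=
  { G of Group G & Order.Total d G & Group_isOrderedAbelian d G }.

(* A strictly increasing bijection between linear orders is an isomorphism. *)
Definition chain_iso (S T : Type) (ltS : S -> S -> Prop) (ltT : T -> T -> Prop)
    (A : set S) (B : set T) (f : S -> T) : Prop :=
  set_bij A B f /\ (forall x y, A x -> A y -> ltS x y -> ltT (f x) (f y)).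

(* Ordinals are represented by well-ordered types, the smaller ordinals being *)
(* the proper initial segments.                                               *)
Section Cardinals.
Variables (d : Order.disp_t) (kappa : orderType d).

Definition well_ordered : Prop :=
  forall A : set kappa, A !=set0 ->
    exists2 x, A x & forall y, A y -> (x <= y)%O.

Definition segment (i : kappa) : set kappa := [set j | (j < i)%O].

Definition initial_ordinal : Prop :=
  well_ordered /\ forall i, ~ ([set: kappa] #= segment i)%card.

(* No map from a smaller ordinal into kappa is cofinal. *)
Definition full_cofinality : Prop :=
  forall (i : kappa) (f : kappa -> kappa),
    exists b, forall j, segment i j -> (f j < b)%O.

Definition regular_uncountable_cardinal : Prop :=
  [/\ initial_ordinal, full_cofinality & ~ countable [set: kappa]].

End Cardinals.

Section ExponentialField.
Variable k : rcfType.

Definition exponential (e : k -> k) : Prop :=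
  chain_iso (fun x y => x < y) (fun x y => x < y)
            [set: k] [set x | 0 < x] e
  /\ (forall x y, e (x + y) = e x * e y).

Definition klog (e : k -> k) (r : k) : k := xget 0 [set s | e s = r].

End ExponentialField.

(* A formal series is given by its coefficient function G -> k.  Addition,    *)
(* opposite and 0 are the pointwise ones already present on function types;   *)
(* the library's pointwise product on G -> k is not the Cauchy product hmul   *)
(* and is never used.                                                         *)
Section HahnField.
Variables (d : Order.disp_t) (G : oAbGroupType d) (k : rcfType).
Implicit Types (x y eps : G -> k) (g a : G) (r c : k).

Definition hsupp x : set G := [set g | x g != 0].

Definition reverse_well_ordered (S : set G) : Prop :=
  forall A : set G, A `<=` S -> A !=set0 ->
    exists2 m, A m & forall g, A g -> (g <= m)%O.

Definition hahn : set (G -> k) := [set x | reverse_well_ordered (hsupp x)].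

Definition monom g r : G -> k := fun a => if a == g then r else 0.

Definition hone : G -> k := monom 1%g 1.

(* For x and y in hahn only finitely many summands are nonzero. *)
Definition hmul x y : G -> k :=
  fun g => \sum_(a \in [set: G]) x a * y (a^-1 * g)%g.

Definition hpow x n : G -> k := iter n (hmul x) hone.

Definition hpos x : Prop :=
  exists g, 0 < x g /\ (forall a, (g < a)%O -> x a = 0).

Definition hlt x y : Prop := hpos (y - x).

Definition habs x : G -> k := if `[< hlt x 0 >] then - x else x.

Definition hprec x y : Prop :=
  forall c, 0 < c -> hlt (hmul (monom 1%g c) (habs x)) (habs y).

(* For eps in hahn infinitesimal, each monomial occurs in eps ^ n for only    *)
(* finitely many n (Neumann), so the coefficientwise sums are finite.         *)
Definition hlog1p eps : G -> k :=
  fun g => \sum_(n \in [set n : nat | (1 <= n)%N])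
             ((-1) ^+ n.+1 / n%:R * hpow eps n g).

End HahnField.

Arguments hone {d G k}.

Section BoundedHahnField.
Variables (d' : Order.disp_t) (kappa : orderType d').
Variables (d : Order.disp_t) (G : oAbGroupType d) (k : rcfType).

Definition order_type_lt (S : set G) : Prop :=
  exists (i : kappa) (f : G -> kappa),
    chain_iso (fun a b => (b < a)%O) (fun j l => (j < l)%O) S (segment i) f.

Definition bhahn : set (G -> k) :=
  [set x | hahn x /\ order_type_lt (hsupp x)].

Definition bhahn_pos : set (G -> k) := [set x | bhahn x /\ hlt 0 x].

Definition group_gt1 : set G := [set g | (1%g < g)%O].

Definition omega_map (w : (G -> k) -> G) : Prop :=
  chain_iso (@hlt d G k) (fun a b => (a < b)%O) bhahn [set: G] w
  /\ (forall x y, bhahn x -> bhahn y -> w (x + y) = (w x * w y)%g).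

Definition analytic_log (e : k -> k) (lg : (G -> k) -> (G -> k)) : Prop :=
  [/\ set_fun bhahn_pos bhahn lg /\ set_surj bhahn_pos bhahn lg,
      (forall x y, bhahn_pos x -> bhahn_pos y -> hlt x y -> hlt (lg x) (lg y))
      /\ (forall x y, bhahn_pos x -> bhahn_pos y ->
            lg (hmul x y) = lg x + lg y),
      (forall r, 0 < r -> lg (monom 1%g r) = monom 1%g (klog e r)),
      (forall eps, bhahn eps -> hprec eps hone ->
         lg (hone + eps) = hlog1p eps)
    & lg @` [set monom g 1 | g in [set: G]] =
      [set x | hsupp x `<=` group_gt1] `&` bhahn].

Section InducedLog.
Variables (e : k -> k) (w : (G -> k) -> G) (h : (G -> k) -> (G -> k)).

(* The sum of w (h x_i) r_i over i < alpha is indexed here by the exponents   *)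
(* z = x_i themselves, with r_i = x (w z); when w and h are injective, each   *)
(* monomial occurs at most once.                                              *)
Definition induced_log_monom (g : G) : G -> k :=
  let x := xget 0 [set x | bhahn x /\ w x = g] in
  fun a => \sum_(z \in [set z | bhahn z /\ x (w z) != 0])
             monom (w (h z)) (x (w z)) a.

Definition induced_log (y : G -> k) : G -> k :=
  let: (g, r, eps) :=
    xget (1%g, 1, 0) [set p : G * k * (G -> k) |
      [/\ 0 < p.1.2, bhahn p.2, hprec p.2 hone
        & y = hmul (monom p.1.1 p.1.2) (hone + p.2)]] in
  induced_log_monom g + monom 1%g (klog e r) + hlog1p eps.

End InducedLog.

End BoundedHahnField.

Arguments bhahn {d'} kappa {d} G k.
Arguments bhahn_pos {d'} kappa {d} G k.
Arguments group_gt1 {d} G.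
Arguments induced_log {d'} kappa {d G k} e w h y.

(* Main.v *)
Require Import Defs.
From HB Require Import structures.
From mathcomp Require Import all_boot all_order all_algebra.
From mathcomp Require Import boolp classical_sets functions cardinality fsbigop.

Set Implicit Arguments.
Unset Strict Implicit.
Unset Printing Implicit Defensive.

Import Order.TTheory GRing.Theory Num.Theory.

Local Open Scope classical_set_scope.
Local Open Scope ring_scope.

(** If [w] is an omega-map, then [w \o exp \o w^-1] is an isomorphism of chains
from [G] onto [w (K^{>0}) = G^{>1}].  Conversely, an isomorphism of chains [f]
from [G] onto [G^{>1}] induces an ordered group isomorphism
[F : sum g r_g |-> sum f(g) r_g] from [K] onto the series with support in
[G^{>1}], that is, onto [log G].  So [w := log^-1 \o F] is an omega-map, and
with [h := w^-1 \o f \o w] one gets [log (w x) = F x = sum w(h x_i) r_i] for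
[x = sum w(x_i) r_i]: the induced logarithm agrees with [log] on [G], and
therefore everywhere. *)

(** * Order, monomial products and infinitesimals for formal series *)

Section HahnSeries.
Variables (d : Order.disp_t) (G : oAbGroupType d) (k : rcfType).
Implicit Types (x y : G -> k) (g a b : G) (r : k).

Lemma hpos_asym x : hpos x -> hpos (- x) -> False.
Proof.
move=> [g [xg0 xg]] [a [xa0 xa]].
have {}xa0 : x a < 0 by rewrite -oppr_gt0; exact: xa0.
have {}xa b : (a < b)%O -> x b = 0.
  by move=> /xa xb; apply/eqP; rewrite -oppr_eq0; apply/eqP.
case: (ltgtP g a) => [/xg xE|/xa xE|eq_ga].
- by rewrite xE ltxx in xa0.
- by rewrite xE ltxx in xg0.
- by rewrite eq_ga in xg0; have := lt_trans xg0 xa0; rewrite ltxx.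
Qed.

Lemma hltxx x : ~ hlt x x.
Proof. by rewrite /hlt subrr => -[g []]; rewrite [X in 0 < X]/= ltxx. Qed.

Lemma hlt_asym x y : hlt x y -> hlt y x -> False.
Proof. by rewrite /hlt -(opprB y x); exact: hpos_asym. Qed.

Lemma hahn_hpos x : hahn x -> [\/ x = 0, hpos x | hpos (- x)].
Proof.
move=> hx; have [x0|x_neq0] := pselect (hsupp x = set0).
  apply: Or31; apply/funext => g; apply/eqP; apply: contraT => xg.
  by have : hsupp x g by []; rewrite x0.
have /set0P supp_x : hsupp x != set0 by apply/eqP.
have [g xg gmax] := hx _ (@subset_refl _ _) supp_x.
have top a : (g < a)%O -> x a = 0.
  move=> ga; apply/eqP; apply: contraTT ga => xa.
  by rewrite -leNgt; apply: gmax.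
case: (ltgtP 0 (x g)) => [x_gt0|x_lt0|x0].
- by apply: Or32; exists g.
- apply: Or33; exists g; split; first by rewrite !fctE oppr_gt0.
  by move=> a /top xa; rewrite !fctE xa oppr0.
- by move: xg; rewrite /hsupp /= -x0 eqxx.
Qed.

(** A subset of the union of the two supports has as maximum the larger of its maxima on each of
    them; the cases allow one intersection to be empty. Differences are what the order [hlt] is
    about, so this gives totality. *)
Lemma hahnB x y : hahn x -> hahn y -> hahn (y - x).
Proof.
move=> hx hy A sA [c Ac].
have AU a : A a -> hsupp x a \/ hsupp y a.
  move=> /sA; rewrite /hsupp /= => xya.
  case: (eqVneq (x a) 0) => [xa|]; last by left.
  by right; apply: contra_neq xya => ya; rewrite !fctE ya xa subrr.
have maxI (z : G -> k) : hahn z -> (A `&` hsupp z) !=set0 ->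
    exists2 m, A m & forall g, A g -> hsupp z g -> (g <= m)%O.
  move=> hz Az; have [m [Am _] mP] := hz _ (@subIsetr _ _ _) Az.
  by exists m => // g Ag zg; apply: mP.
have [/(maxI _ hx)[m Am mP]|Ax0] := pselect ((A `&` hsupp x) !=set0);
  have [/(maxI _ hy)[n An nP]|Ay0] := pselect ((A `&` hsupp y) !=set0).
- exists (Order.max m n); first by case: leP.
  move=> g Ag; rewrite le_max; apply/orP.
  by case: (AU g Ag) => [xg|yg]; [left; apply: mP|right; apply: nP].
- exists m => // g Ag; case: (AU g Ag) => [|yg]; first exact: mP.
  by case: Ay0; exists g.
- exists n => // g Ag; case: (AU g Ag) => [xg|]; last exact: nP.
  by case: Ax0; exists g.
- by case: (AU c Ac) => ?; [case: Ax0|case: Ay0]; exists c.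
Qed.

Lemma hlt_total x y : hahn x -> hahn y -> [\/ x = y, hlt x y | hlt y x].
Proof.
move=> hx hy; case: (hahn_hpos (hahnB hx hy)) => [/eqP|xy|].
- by rewrite subr_eq0 => /eqP ->; apply: Or31.
- by apply: Or32.
- by rewrite opprB => yx; apply: Or33.
Qed.

Lemma monomE g r a : monom g r a = if a == g then r else 0.
Proof. by []. Qed.

(** Only the summand at [g] survives. Every Cauchy product that the proof evaluates has a monomial
    as left factor, so this formula is all the multiplication it needs. *)
Lemma hmul_monom g r x : hmul (monom g r) x = fun a => r * x (g^-1 * a)%g.
Proof.
apply/funext => a; rewrite /hmul -(fsbig_widen [set g]) //=; last first.
  by move=> b [_ /eqP bg]; rewrite /preimage /= monomE (negPf bg) mul0r.
by rewrite fsbig_set1 monomE eqxx.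
Qed.

Lemma hmul_monom_monom g r a s :
  hmul (monom g r) (monom a s) = monom (g * a)%g (r * s) :> (G -> k).
Proof.
rewrite hmul_monom; apply/funext => b; rewrite !monomE.
have -> : (g^-1 * b == a)%g = (b == g * a)%g.
  by apply/eqP/eqP => [<-|->]; rewrite ?mulVKg ?mulKg.
by case: eqP; rewrite ?mulr0.
Qed.

Lemma oabg_lt_mul2lE g : {mono (fun a => g * a)%g : a b / (a < b)%O}.
Proof.
move=> a b; apply/idP/idP => [|]; last exact: oabg_lt_mul2l.
by move=> /(oabg_lt_mul2l _ _ g^-1%g); rewrite !mulKg.
Qed.

Lemma hlt_monom g a : (g < a)%O -> hlt (monom g 1 : G -> k) (monom a 1).
Proof.
move=> ga; exists a; split=> [|b ab].
  by rewrite !fctE !monomE eqxx (gt_eqF ga) subr0 ltr01.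
rewrite !fctE !monomE (gt_eqF ab) (gt_eqF (lt_trans ga ab)).
by rewrite subrr.
Qed.

Lemma hlt_monomK g a : hlt (monom g 1 : G -> k) (monom a 1) -> (g < a)%O.
Proof.
move=> ga; rewrite ltNge le_eqVlt; apply/negP => /orP[/eqP ag|].
  by rewrite ag in ga; case: (hltxx ga).
by move=> /hlt_monom; apply: hlt_asym.
Qed.

Lemma hlt0_monom g r : 0 < r -> hlt (0 : G -> k) (monom g r).
Proof.
move=> r0; exists g; split=> [|a ga].
  by rewrite subr0 monomE eqxx.
by rewrite subr0 monomE (gt_eqF ga).
Qed.

(** Nonnegativity is put negatively because a series with arbitrary support need not have a leading
    coefficient. *)
Lemma habs_ge0 x : ~ hpos (- habs x).
Proof.
rewrite /habs; case: asboolP => [x0|x0 xN].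
  by apply: hpos_asym; rewrite -(sub0r x).
by apply: x0; rewrite /hlt sub0r.
Qed.

Lemma habs_hone : habs (hone : G -> k) = hone.
Proof.
rewrite /habs; case: asboolP => // h; case: (hlt_asym h).
exact: hlt0_monom ltr01.
Qed.

(** For each [c > 0] the series [1 - c|x|] has a positive leading coefficient. Taking [c = 1] kills
    the coefficients of [|x|] above the exponent 1, and a large [c] kills the one at 1. *)
Lemma hprec1_eq0 x g : hprec x hone -> (1%g <= g)%O -> x g = 0.
Proof.
move=> x_prec.
set A := habs x.
have lead c : 0 < c -> exists b, 0 < hone b - c * A b /\
    forall a, (b < a)%O -> hone a - c * A a = 0.
  move=> /x_prec; rewrite /hlt habs_hone hmul_monom => -[b [b0 bP]].
  exists b; split=> [|a /bP].
    by move: b0; rewrite !fctE invg1 mul1g.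
  by rewrite !fctE invg1 mul1g.
have hone_gt1 a : (1%g < a)%O -> hone a = 0 :> k.
  by move=> a1; rewrite /hone monomE (gt_eqF a1).
have A_gt1 a : (1%g < a)%O -> A a = 0.
  have [b [b0 bP]] := lead 1 ltr01.
  (* A leading exponent [b] of [1 - |x|] above 1 would also be a leading exponent of [-|x|], with
     positive coefficient. *)
  have [b1|b1 a1] := ltP 1%g b.
    case: (@habs_ge0 x); exists b; split=> [|c bc].
      by move: b0; rewrite (hone_gt1 _ b1) mul1r sub0r.
    have := bP c bc; rewrite (hone_gt1 _ (lt_trans b1 bc)) mul1r sub0r.
    exact.
  have := bP a (le_lt_trans b1 a1).
  by rewrite hone_gt1// mul1r sub0r => /eqP; rewrite oppr_eq0 => /eqP.
have A1 : A 1%g = 0.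
  case: (ltgtP (A 1%g) 0) => // [A1_lt0|A1_gt0].
    case: (@habs_ge0 x); exists 1%g; split=> [|c c1].
      by rewrite !fctE oppr_gt0.
    by rewrite !fctE -/A A_gt1// oppr0.
  (* With this constant the coefficient of [1 - c|x|] at 1 is [1 - 2 = -1], and all higher ones
     vanish, so no position is left for a positive leading coefficient. *)
  have c0 : 0 < 2 / A 1%g by rewrite divr_gt0.
  have [b [b0 bP]] := lead _ c0.
  have val1 : hone (1%g : G) - 2 / A 1%g * A 1%g = -1 :> k.
    rewrite /hone monomE eqxx divfK ?gt_eqF//.
    by apply/eqP; rewrite subr_eq addrC -subr_eq opprK.
  case: (ltgtP b 1%g) => [/bP|b1|b1].
  - by rewrite val1 => /eqP; rewrite oppr_eq0 oner_eq0.
  - by move: b0; rewrite hone_gt1// (A_gt1 _ b1) mulr0 subrr ltxx.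
  - by move: b0; rewrite b1 val1 oppr_gt0 ltNge ler01.
have xA : A g = 0 -> x g = 0.
  rewrite /A /habs; case: asboolP => // _ /eqP.
  by rewrite !fctE oppr_eq0 => /eqP.
by rewrite le_eqVlt => /orP[/eqP g1|/A_gt1/xA//]; apply: xA; rewrite -g1.
Qed.

(** The leading term of [1 - c|x|] is then 1, whatever [c] is. *)
Lemma eq0_hprec1 x : (forall g, (1%g <= g)%O -> x g = 0) -> hprec x hone.
Proof.
move=> x0 c _; have {}x0 g : (1%g <= g)%O -> habs x g = 0.
  by move=> /x0 xg; rewrite /habs; case: asboolP => //; rewrite fctE xg oppr0.
rewrite /hlt habs_hone hmul_monom.
exists 1%g; split=> [|a a1]; rewrite !fctE invg1 mul1g.
  by rewrite (x0 _ (lexx _)) mulr0 subr0 /hone monomE eqxx.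
by rewrite (x0 _ (ltW a1)) mulr0 subr0 /hone monomE gt_eqF.
Qed.

End HahnSeries.

(** * Series with support of reverse order type below [kappa], and general facts on omega-maps *)

Section BoundedSeries.
Variables (d' : Order.disp_t) (kappa : orderType d').
Variables (d : Order.disp_t) (G : oAbGroupType d) (k : rcfType).
Implicit Types (x y : G -> k) (g a b : G) (r : k).

(** Membership depends only on the support as a chain, so it passes along any order isomorphism of
    supports. Translations by a group element and the transport along [f] are both instances. *)
Lemma bhahn_reindex (phi : G -> G) x y :
    set_bij (hsupp x) (hsupp y) phi ->
    (forall a b, hsupp x a -> hsupp x b -> (a < b)%O -> (phi a < phi b)%O) ->
  bhahn kappa G k y -> bhahn kappa G k x.
Proof.
move=> phi_bij phi_lt [hy [i [f [f_bij f_lt]]]].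
have phi_fun a : hsupp x a -> hsupp y (phi a).
  by case: phi_bij => + _ _ => /[apply].
split.
  move=> A sA [a Aa]; have phiA : phi @` A `<=` hsupp y.
    by move=> _ [b Ab <-]; apply/phi_fun/sA.
  have [_ [m Am <-] mP] := hy _ phiA (ex_intro _ _ (imageP phi Aa)).
  exists m => // g Ag; rewrite leNgt; apply/negP => mg.
  have := mP (phi g) (imageP phi Ag).
  by rewrite leNgt phi_lt//; apply: sA.
exists i, (f \o phi); split; first exact: set_bij_comp phi_bij f_bij.
move=> a b xa xb ba; apply: f_lt; [exact: phi_fun|exact: phi_fun|].
exact: phi_lt.
Qed.

Lemma bhahn_translate g r x : r != 0 -> bhahn kappa G k x ->
  bhahn kappa G k (fun a => r * x (g * a)%g).
Proof.
move=> r0; apply: (@bhahn_reindex (fun a => g * a)%g); last first.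
  by move=> a b _ _; rewrite oabg_lt_mul2lE.
split.
- by move=> a; rewrite /hsupp /= mulf_eq0 (negPf r0).
- by move=> a b _ _; apply: mulgI.
- move=> a xa; exists (g^-1 * a)%g; last by rewrite mulVKg.
  by rewrite /hsupp /= mulVKg mulf_neq0.
Qed.

Lemma bhahn0 : regular_uncountable_cardinal kappa ->
  bhahn kappa G k 0.
Proof.
move=> [[wo _] _ unc]; split.
  by move=> A sA [a /sA]; rewrite /hsupp /= eqxx.
have kappa_neq0 : [set: kappa] !=set0.
  by apply/set0P/eqP => k0; apply: unc; rewrite k0; exact: countable0.
have [i0 _ i0P] := wo _ kappa_neq0.
(* The segment below the least element [i0] is empty, like the support of 0. *)
exists i0, (fun=> i0); split; last first.
  by move=> a b; rewrite /hsupp /= eqxx.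
split.
- by move=> a; rewrite /hsupp /= eqxx.
- by move=> a b; rewrite inE /hsupp /= eqxx.
- by move=> j; rewrite /segment /= ltNge i0P.
Qed.

Lemma bhahn_monom g r : regular_uncountable_cardinal kappa -> r != 0 ->
  bhahn kappa G k (monom g r).
Proof.
move=> [[wo _] _ unc] r0.
have suppE : hsupp (monom g r) = [set g].
  apply/seteqP; split=> a; rewrite /hsupp /= monomE; last by move=> ->; rewrite eqxx.
  by case: (eqVneq a g) => //; rewrite eqxx.
rewrite /bhahn /= /hahn /= suppE; split.
  move=> A sA [a Aa]; exists a => // b Ab.
  by rewrite (sA _ Aa) (sA _ Ab).
have kappa_neq0 : [set: kappa] !=set0.
  by apply/set0P/eqP => k0; apply: unc; rewrite k0; exact: countable0.
have [i0 _ i0P] := wo _ kappa_neq0.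
(* Being uncountable, [kappa] has an element other than its least one; the least such [i1] has the
   one-point segment [{i0}], the order type of the support of a monomial. *)
have : [set i | (i0 < i)%O] !=set0.
  apply/set0P/eqP => k0; apply: unc.
  suff -> : [set: kappa] = [set i0] by exact: countable1.
  apply/seteqP; split=> // i _; apply/eqP.
  have := i0P i I; rewrite le_eqVlt => /orP[/eqP -> //|i0i].
  by have : [set i | (i0 < i)%O] i by []; rewrite k0.
move=> /wo[i1 i01 i1P].
exists i1, (fun=> i0); split; last by move=> a b -> ->; rewrite ltxx.
split=> [a _ //|a b|j].
  by rewrite !inE => -> ->.
rewrite /segment /= => ji1; exists g => //.
have := i0P j I; rewrite le_eqVlt => /orP[/eqP //|/i1P].
by rewrite leNgt ji1.
Qed.

Lemma bhahn_pos_monom g r : regular_uncountable_cardinal kappa -> 0 < r ->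
  bhahn_pos kappa G k (monom g r).
Proof.
move=> hk r0; split; last exact: hlt0_monom.
by apply: bhahn_monom; rewrite ?gt_eqF.
Qed.

Lemma hlt_total_bhahn x y : bhahn kappa G k x -> bhahn kappa G k y ->
  [\/ x = y, hlt x y | hlt y x].
Proof. by move=> [hx _] [hy _]; apply: hlt_total. Qed.

Lemma chain_iso_reflect (f : G -> G) (B : set G) :
  chain_iso (fun a b => (a < b)%O) (fun a b => (a < b)%O) [set: G] B f ->
  {mono f : a b / (a < b)%O}.
Proof.
move=> [_ f_lt]; have f_homo a b : (a < b)%O -> (f a < f b)%O by apply: f_lt.
move=> a b; apply/idP/idP => [|/f_homo//]; apply: contraTT.
rewrite -!leNgt le_eqVlt => /orP[/eqP -> //|/f_homo]; exact: ltW.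
Qed.

Lemma omega_map_reflect (w : (G -> k) -> G) x y : omega_map kappa w ->
  bhahn kappa G k x -> bhahn kappa G k y -> (w x < w y)%O -> hlt x y.
Proof.
move=> [[_ w_lt] _] bx b_y wxy.
case: (hlt_total_bhahn bx b_y) => // [xy|/(w_lt _ _ b_y bx)].
  by rewrite xy ltxx in wxy.
by move=> /(lt_trans wxy); rewrite ltxx.
Qed.

Lemma omega_map_gt1 (w : (G -> k) -> G) x :
    regular_uncountable_cardinal kappa -> omega_map kappa w ->
    bhahn kappa G k x ->
  group_gt1 G (w x) <-> hlt 0 x.
Proof.
move=> hk hw bx; have b0 := bhahn0 hk.
(* Cancel [w 0] in [w (0 + 0) = w 0 * w 0]. *)
have w0 : w 0 = 1%g.
  have /(congr1 (fun g => (w 0)^-1 * g)%g) := hw.2 _ _ b0 b0.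
  by rewrite addr0 mulVg mulKg => <-.
rewrite /group_gt1 /= -w0; split; first exact: omega_map_reflect.
exact: hw.1.2.
Qed.

End BoundedSeries.

(** * The analytic logarithm, and the chain isomorphism obtained from an omega-map *)

Section AnalyticLog.
Variables (d' : Order.disp_t) (kappa : orderType d').
Variables (d : Order.disp_t) (G : oAbGroupType d) (k : rcfType).
Variables (e : k -> k) (lg : (G -> k) -> (G -> k)).
Hypothesis hkappa : regular_uncountable_cardinal kappa.
Hypothesis hlg : analytic_log kappa e lg.
Implicit Types (x y : G -> k) (g a b : G) (r : k).

Local Notation K := (bhahn kappa G k).
Local Notation Kpos := (bhahn_pos kappa G k).

Let lgm g := lg (monom g 1).

Let Kpos_monom g : Kpos (monom g 1).
Proof. exact: bhahn_pos_monom ltr01. Qed.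

Lemma lg_inj : set_inj Kpos lg.
Proof.
case: hlg => _ [lg_lt _] _ _ _ x y; rewrite !inE => Kx Ky lxy.
case: (hlt_total_bhahn Kx.1 Ky.1) => // xy.
- by case: (@hltxx _ _ _ (lg x)); rewrite {2}lxy; apply: lg_lt.
- by case: (@hltxx _ _ _ (lg x)); rewrite {1}lxy; apply: lg_lt.
Qed.

Lemma lg_reflect x y : Kpos x -> Kpos y -> hlt (lg x) (lg y) -> hlt x y.
Proof.
case: hlg => _ [lg_lt _] _ _ _ Kx Ky lxy.
case: (hlt_total_bhahn Kx.1 Ky.1) => // [xy|yx].
- by rewrite xy in lxy; case: (hltxx lxy).
- by case: (hlt_asym lxy); apply: lg_lt.
Qed.

Lemma gt1_chain_of_omega (w : (G -> k) -> G) : omega_map kappa w ->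
  exists f : G -> G,
    chain_iso (fun a b => (a < b)%O) (fun a b => (a < b)%O)
              [set: G] (group_gt1 G) f.
Proof.
move=> hw; have [[[w_fun w_inj w_surj] w_lt] _] := hw.
have [[lg_fun lg_surj] _ _ _ _] := hlg.
(* [v] is the inverse of [w] with values in [K], and [ex] below is the exponential, inverse to [lg];
   its value outside [K] is irrelevant. The required map is [w \o ex \o v]. *)
have /choice[v vP] g : exists x, K x /\ w x = g.
  by have [x Kx <-] := w_surj g I; exists x.
have /choice[ex exP] x : exists y, K x -> Kpos y /\ lg y = x.
  have [Kx|] := pselect (K x); last by exists 0.
  by have [y Ky <-] := lg_surj x Kx; exists y.
have Kex g : Kpos (ex (v g)) by case: (exP _ (vP g).1).
have lgex g : lg (ex (v g)) = v g by case: (exP _ (vP g).1).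
exists (fun g => w (ex (v g))); split; last first.
  move=> a b _ _ ab; apply: w_lt; [exact: (Kex a).1|exact: (Kex b).1|].
  apply: lg_reflect => //; rewrite !lgex.
  by apply: (omega_map_reflect hw (vP a).1 (vP b).1); rewrite !(vP _).2.
split.
- move=> g _; apply/(omega_map_gt1 hkappa hw (Kex g).1).
  exact: (Kex g).2.
- move=> a b _ _ /(w_inj _ _ (mem_set (Kex a).1) (mem_set (Kex b).1)).
  by move=> /(congr1 lg); rewrite !lgex => /(congr1 w); rewrite !(vP _).2.
- move=> g g1; have [Kvg wvg] := vP g.
  have Kpvg : Kpos (v g).
    by split=> //; apply/(omega_map_gt1 hkappa hw Kvg); rewrite wvg.
  (* The preimage of [g] is obtained by running the composite backwards; [lg] may be applied because
     [g > 1] makes [v g] positive. *)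
  exists (w (lg (v g))) => //; rewrite -[RHS]wvg; congr w.
  have -> : v (w (lg (v g))) = lg (v g).
    apply: w_inj; rewrite ?(vP _).2// inE; [exact: (vP _).1|exact: lg_fun].
  have [Ky ly] := exP _ (lg_fun _ Kpvg).
  by apply: lg_inj => //; rewrite inE.
Qed.

(** * The logarithm restricted to monomials *)

Let lgm_mul a b : lgm (a * b)%g = lgm a + lgm b.
Proof.
case: hlg => _ [_ lgM] _ _ _.
by rewrite /lgm -lgM// hmul_monom_monom mulr1.
Qed.

Let lgm_lt a b : (a < b)%O -> hlt (lgm a) (lgm b).
Proof. by case: hlg => _ [lg_lt _] _ _ _ ab; apply: lg_lt => //; exact: hlt_monom. Qed.

Let lgm_range a : hsupp (lgm a) `<=` group_gt1 G /\ K (lgm a).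
Proof.
case: hlg => _ _ _ _ rangeE.
suff : (lg @` [set monom g 1 | g in [set: G]]) (lgm a) by rewrite rangeE.
by apply: imageP; apply: imageP.
Qed.

Let lgm_surj x : hsupp x `<=` group_gt1 G -> K x -> exists a, lgm a = x.
Proof.
case: hlg => _ _ _ _ rangeE x1 Kx.
suff : (lg @` [set monom g 1 | g in [set: G]]) x by case=> _ [a _ <-] <-; exists a.
by rewrite rangeE.
Qed.

(** * Transport of series along a chain isomorphism [f] from [G] onto its part above 1 *)

Variable f : G -> G.
Hypothesis hf : chain_iso (fun a b => (a < b)%O) (fun a b => (a < b)%O)
  [set: G] (group_gt1 G) f.

(** This is the map [F] that replaces each monomial [g] by [f g], given coefficientwise through the
    inverse of [f]. It makes sense for all functions, so additivity and injectivity need no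
    condition on supports. *)
Definition reindex x : G -> k :=
  fun a => if (1%g < a)%O then x (xget 1%g [set b | f b = a]) else 0.

Let f_mono : {mono f : a b / (a < b)%O}.
Proof. exact: chain_iso_reflect hf. Qed.

Let f_inj : injective f.
Proof. by case: hf => -[_ finj _] _ a b; apply: finj; rewrite inE. Qed.

Let f_gt1 a : (1%g < f a)%O.
Proof. by case: hf => -[ffun _ _] _; apply: (ffun a). Qed.

Let f_surj a : (1%g < a)%O -> exists b, f b = a.
Proof. by case: hf => -[_ _ fsurj] _ /fsurj[b _ <-]; exists b. Qed.

Lemma reindex_f x b : reindex x (f b) = x b.
Proof.
rewrite /reindex f_gt1; congr x; apply: f_inj.
by apply: (@xgetPex _ 1%g [set c | f c = f b]); exists b.
Qed.

Lemma reindex_supp x : hsupp (reindex x) = f @` hsupp x.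
Proof.
apply/seteqP; split=> a; last by case=> b xb <-; rewrite /hsupp /= reindex_f.
rewrite /hsupp /= => xa.
have /f_surj[b ba] : (1%g < a)%O.
  by move: xa; rewrite /reindex; case: ifP => //; rewrite eqxx.
by exists b => //; rewrite -reindex_f ba.
Qed.

Lemma reindexD x y : reindex (x + y) = reindex x + reindex y.
Proof.
by apply/funext => a; rewrite /reindex !fctE; case: ifP => //; rewrite addr0.
Qed.

Lemma reindexB x y : reindex (x - y) = reindex x - reindex y.
Proof.
by apply/funext => a; rewrite /reindex !fctE; case: ifP => //; rewrite subr0.
Qed.

Lemma reindex_inj : injective reindex.
Proof.
by move=> x y xy; apply/funext => a; rewrite -(reindex_f x) -(reindex_f y) xy.
Qed.

Lemma reindex_gt1 x : hsupp (reindex x) `<=` group_gt1 G.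
Proof. by rewrite reindex_supp => _ [a _ <-]; exact: f_gt1. Qed.

Lemma reindex_surj y : hsupp y `<=` group_gt1 G -> exists x, reindex x = y.
Proof.
move=> y1; exists (y \o f); apply/funext => a.
case: (boolP (1%g < a)%O) => [/f_surj[b <-]|a1]; first by rewrite reindex_f.
rewrite /reindex (negPf a1); apply/esym/eqP.
by apply: contraNT a1 => /y1.
Qed.

Lemma bhahn_of_reindex x : K (reindex x) -> K x.
Proof.
apply: (@bhahn_reindex _ _ _ _ _ f); last by move=> a b _ _; rewrite f_mono.
rewrite reindex_supp; split; first by move=> a xa; exists a.
- by move=> a b _ _; apply: f_inj.
- by move=> _ [a xa <-]; exists a.
Qed.

Lemma bhahn_reindexed x : K x -> K (reindex x).
Proof.
(* [fi] inverts [f] above 1 and is arbitrary elsewhere; the support of [reindex x] lies above 1. *)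
have /choice[fi fiP] a : exists b, (1%g < a)%O -> f b = a.
  case: (boolP (1%g < a)%O) => [/f_surj[b ba]|]; last by exists a.
  by exists b.
have fK b : fi (f b) = b by apply: f_inj; rewrite fiP.
apply: (@bhahn_reindex _ _ _ _ _ fi); rewrite reindex_supp; last first.
  by move=> _ _ [a _ <-] [b _ <-]; rewrite !fK f_mono.
split.
- by move=> _ [a xa <-]; rewrite fK.
- by move=> _ _ /set_mem[a _ <-] /set_mem[b _ <-]; rewrite !fK => ->.
- by move=> a xa; exists (f a); rewrite ?fK//; exists a.
Qed.

(** The leading exponent [g] of the difference moves to [f g]: an exponent above [f g] exceeds 1,
    hence is some [f b] with [b > g]. *)
Lemma hlt_reindex x y : hlt x y -> hlt (reindex x) (reindex y).
Proof.
rewrite /hlt -reindexB => -[g [g0 gP]]; exists (f g); rewrite reindex_f.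
split=> // a ga; have /f_surj[b ba] := lt_trans (f_gt1 g) ga.
by rewrite -ba reindex_f gP// -f_mono ba.
Qed.

(* [reindex x + reindex y] is again the logarithm of a monomial, hence lies in
   [K]: no arithmetic of order types is needed. *)
Lemma bhahnD x y : K x -> K y -> K (x + y).
Proof.
move=> /bhahn_reindexed/(lgm_surj (@reindex_gt1 x))[a ax].
move=> /bhahn_reindexed/(lgm_surj (@reindex_gt1 y))[b b_y].
apply: bhahn_of_reindex; rewrite reindexD -ax -b_y -lgm_mul.
exact: (lgm_range _).2.
Qed.

(** * The omega-map built from [f], and the induced chain isomorphism of [K] with its positive
    part *)

Definition omega x : G := xget 1%g [set g | lg (monom g 1) = reindex x].

Lemma lg_omega x : K x -> lg (monom (omega x) 1) = reindex x.
Proof.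
move=> /bhahn_reindexed/(lgm_surj (@reindex_gt1 x))[a ax].
by apply: (@xgetPex _ 1%g [set g | lg (monom g 1) = reindex x]); exists a.
Qed.

Let lgm_inj : injective lgm.
Proof.
by move=> a b lab; case: (ltgtP a b) => // /lgm_lt; rewrite lab => /hltxx.
Qed.

(** Each property is checked after applying [lg] to monomials, which is injective and reflects the
    order; there [omega] becomes [reindex]. *)
Lemma omega_map_omega : omega_map kappa omega.
Proof.
split; last first.
  move=> x y Kx Ky; apply: lgm_inj; rewrite lgm_mul /lgm !lg_omega//.
    exact: reindexD.
  exact: bhahnD.
split; last first.
  move=> x y Kx Ky /hlt_reindex; rewrite -!lg_omega// => oxy.
  by apply: hlt_monomK; apply: lg_reflect oxy.
split=> //.
- move=> x y /set_mem Kx /set_mem Ky oxy; apply: reindex_inj.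
  by rewrite -!lg_omega// oxy.
- move=> g _; have [g1 Kg] := lgm_range g.
  have [x xE] := reindex_surj g1.
  have Kx : K x by apply: bhahn_of_reindex; rewrite xE.
  by exists x => //; apply: lgm_inj; rewrite /lgm lg_omega.
Qed.

Definition shift x : G -> k := xget 0 [set z | K z /\ omega z = f (omega x)].

(** This holds for every [x], in [K] or not, because [omega] maps [K] onto [G]: the default 0 in
    [shift] is never resorted to. *)
Lemma shiftP x : K (shift x) /\ omega (shift x) = f (omega x).
Proof.
apply: (@xgetPex _ 0 [set z | K z /\ omega z = f (omega x)]).
case: omega_map_omega => -[[_ _ osurj] _] _.
by have [z Kz zE] := osurj (f (omega x)) I; exists z.
Qed.

Lemma chain_iso_shift :
  chain_iso (@hlt d G k) (@hlt d G k) K Kpos shift.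
Proof.
have hw := omega_map_omega; have [[[_ o_inj o_surj] o_lt] _] := hw.
split; last first.
  move=> x y Kx Ky xy.
  apply: (omega_map_reflect hw (shiftP x).1 (shiftP y).1).
  by rewrite !(shiftP _).2 f_mono; apply: o_lt.
split.
- move=> x _; split; first exact: (shiftP x).1.
  apply/(omega_map_gt1 hkappa hw (shiftP x).1).
  by rewrite (shiftP x).2; exact: f_gt1.
- move=> x y Kx Ky /(congr1 omega); rewrite !(shiftP _).2 => /f_inj.
  exact: o_inj.
- move=> y [Ky /(omega_map_gt1 hkappa hw Ky)/f_surj[b bE]].
  have [x Kx xb] := o_surj b I; exists x => //.
  apply: o_inj; rewrite ?inE//; first exact: (shiftP x).1.
  by rewrite (shiftP x).2 xb.
Qed.

(** * Comparison of the induced logarithm with [lg] *)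

Lemma induced_log_monomE g :
  induced_log_monom kappa omega shift g = lg (monom g 1).
Proof.
have hw := omega_map_omega; have [[[_ o_inj o_surj] _] _] := hw.
rewrite /induced_log_monom; set x := xget _ _.
have [Kx xg] : K x /\ omega x = g.
  apply: (@xgetPex _ 0 [set x | K x /\ omega x = g]).
  by have [z Kz zE] := o_surj g I; exists z.
rewrite -xg lg_omega//; apply/funext => a.
(* Coefficients are compared at [a]. Every monomial of the sum is a value of [f], so for [a] not
   above 1 both sides vanish. *)
case: (boolP (1%g < a)%O) => [/f_surj[b <-]|a1]; last first.
  rewrite /reindex (negPf a1) fsbig1// => z _.
  rewrite monomE (shiftP z).2; case: eqP => // az.
  by rewrite az f_gt1 in a1.
(* At [a = f b] only the index [z] with [omega z = b] can contribute. *)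
rewrite reindex_f; have [z Kz zb] := o_surj b I.
have term y : K y -> y <> z -> monom (omega (shift y)) (x (omega y)) (f b) = 0.
  move=> Ky yz; rewrite monomE (shiftP y).2 -zb; case: eqP => // /f_inj zy.
  by case: yz; apply: o_inj; rewrite ?inE.
(* If [x b = 0], then [z] is not in the index set, and no term is left. *)
have [xb0|xb] := eqVneq (x b) 0.
  rewrite fsbig1// => y [Ky xy]; apply: term => // yz.
  by rewrite yz zb xb0 eqxx in xy.
rewrite -(fsbig_widen [set z]) /=.
- by rewrite fsbig_set1 monomE (shiftP z).2 zb eqxx.
- by move=> _ ->; rewrite /= zb.
- by move=> y [[Ky _] yz]; apply: term.
Qed.

Lemma monom_hone_decomp y : Kpos y -> exists p : G * k * (G -> k),
  [/\ 0 < p.1.2, K p.2, hprec p.2 hone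
    & y = hmul (monom p.1.1 p.1.2) (hone + p.2)].
Proof.
move=> [Ky [g []]]; rewrite subr0 => yg0 yg.
have yg_neq0 : y g != 0 by rewrite gt_eqF.
(* [u] is [y] divided by its leading term, so the infinitesimal is [u - 1]. Its membership in [K]
   comes from [bhahnD]. *)
pose u a := (y g)^-1 * y (g * a)%g.
exists (g, y g, u + monom 1%g (-1)); split=> //=.
- apply: bhahnD; first by apply: bhahn_translate; rewrite ?invr_eq0.
  by apply: bhahn_monom; rewrite // oppr_eq0 oner_eq0.
- apply: eq0_hprec1 => a; rewrite le_eqVlt => /orP[/eqP <-|a1].
    by rewrite fctE monomE eqxx /u mulg1 mulVf// subrr.
  have ga : (g < (g * a)%g)%O by rewrite -[X in (X < _)%O]mulg1 oabg_lt_mul2lE.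
  by rewrite fctE monomE (gt_eqF a1) /u (yg _ ga) mulr0 addr0.
- rewrite hmul_monom; apply/funext => a.
  have -> : hone + (u + monom 1%g (-1)) = u.
    apply/funext => b; rewrite !fctE /hone !monomE; case: eqP => _.
      by rewrite addrCA subrr addr0.
    by rewrite addr0 add0r.
  by rewrite /u mulVKg mulVKf.
Qed.

Lemma induced_logE y : Kpos y -> induced_log kappa e omega shift y = lg y.
Proof.
move=> Ky; rewrite /induced_log.
(* Uniqueness of the decomposition is not at stake: by multiplicativity of [lg], whichever triple is
   chosen gives [lg y]. *)
have := @xgetPex _ (1%g, 1, 0) _ (monom_hone_decomp Ky).
case: (xget _ _) => -[g r] eps /= [r0 Keps eps1 yE].
have [_ [_ lgM] lgk lg1p _] := hlg.
have Kr : Kpos (monom g r) by apply: bhahn_pos_monom.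
have Kh : Kpos (hone + eps).
  split.
    (* Membership of [1 + eps] in [K] is read off from [y], of which it is a rescaled translate. *)
    have -> : hone + eps = fun a => r^-1 * y (g * a)%g.
      by apply/funext => a; rewrite yE hmul_monom mulKg mulKf// gt_eqF.
    by apply: bhahn_translate Ky.1; rewrite invr_eq0 gt_eqF.
  rewrite /hlt subr0; exists 1%g; rewrite !fctE (hprec1_eq0 eps1)//.
  split=> [|a a1].
    by rewrite addr0 /hone monomE eqxx.
  by rewrite (hprec1_eq0 eps1) ?ltW// addr0 /hone monomE gt_eqF.
rewrite yE lgM// lg1p//; congr (_ + _).
rewrite induced_log_monomE -(lgk _ r0).
by rewrite -lgM//; [rewrite hmul_monom_monom mulg1 mul1r|exact: bhahn_pos_monom].
Qed.

End AnalyticLog.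

Theorem theorem4p1
    (d' : Order.disp_t) (kappa : orderType d')
    (d : Order.disp_t) (G : oAbGroupType d)
    (k : rcfType) (e : k -> k) (lg : (G -> k) -> (G -> k))
    (hkappa : regular_uncountable_cardinal kappa)
    (he : exponential e)
    (hlg : analytic_log kappa e lg) :
  ((exists w : (G -> k) -> G, omega_map kappa w) <->
   (exists f : G -> G,
      chain_iso (fun a b => (a < b)%O) (fun a b => (a < b)%O)
                [set: G] (group_gt1 G) f))
  /\
  ((exists f : G -> G,
      chain_iso (fun a b => (a < b)%O) (fun a b => (a < b)%O)
                [set: G] (group_gt1 G) f) ->
   exists (w : (G -> k) -> G) (h : (G -> k) -> (G -> k)),
     [/\ omega_map kappa w,
         chain_iso (@hlt d G k) (@hlt d G k)
                   (bhahn kappa G k) (bhahn_pos kappa G k) h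
       & forall y, bhahn_pos kappa G k y -> induced_log kappa e w h y = lg y]).

Proof.
split; first split.
- by move=> [w]; exact: gt1_chain_of_omega hkappa hlg w.
- by move=> [f hf]; exists (omega lg f); exact: omega_map_omega hkappa hlg f hf.
- move=> [f hf]; exists (omega lg f), (shift kappa lg f); split.
  + exact: omega_map_omega hkappa hlg f hf.
  + exact: chain_iso_shift hkappa hlg f hf.
  + exact: induced_logE hkappa hlg f hf.
Qed.
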